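(* There exists a randomized algorithm which, given cut-query oracle access to an unweighted, undirected simple graph $G=(V,E)$ on $n$ vertices, makes $\widetilde{O}(n)$ queries and with high probability outputs an exact global minimum cut of $G$.
   Context: A cut query takes a set $S\subseteq V$ and returns $c(S)$, the number of edges of $G$ with exactly one endpoint in $S$. A global minimum cut is a set $S$ with $\emptyset\neq S\subsetneq V$ minimizing $c(S)$. $\widetilde{O}(x)$ denotes $O(x\cdot \mathrm{polylog}(x))$. ''With high probability'' means with probability at least $1-n^{-\Omega(1)}$. *)

(* Defs.v *)
From Stdlib Require Import Reals.
From mathcomp Require Import all_boot.

Set Implicit Arguments.
Unset Strict Implicit.
Unset Printing Implicit Defensive.

Definition simple_graph (n : nat) (g : rel 'I_n) : Prop :=
  symmetric g /\ irreflexive g.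

(* c(S): number of edges with exactly one endpoint in S.  Each such edge
   {u,v} (u in S, v not in S) is counted once, as the ordered pair (u,v). *)
Definition cut_value (n : nat) (g : rel 'I_n) (S : {set 'I_n}) : nat :=
  #|[set e : 'I_n * 'I_n | [&& g e.1 e.2, e.1 \in S & e.2 \notin S]]|.

Definition is_global_min_cut (n : nat) (g : rel 'I_n) (S : {set 'I_n}) : bool :=
  [&& S != set0, S != setT &
      [forall T : {set 'I_n},
          ((T != set0) && (T != setT)) ==> (cut_value g S <= cut_value g T)]].

(* Deterministic adaptive cut-query algorithms on n vertices (decision trees):
   either output a set, or ask a cut query S and continue depending on the
   answer c(S). *)
Inductive qtree (n : nat) : Type :=
| QLeaf of {set 'I_n}
| QAsk of {set 'I_n} & (nat -> qtree n).

Fixpoint run (n : nat) (oracle : {set 'I_n} -> nat) (t : qtree n)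
  : {set 'I_n} * nat :=
  match t with
  | QLeaf X => (X, 0)
  | QAsk X k => let r := run oracle (k (oracle X)) in (r.1, r.2.+1)
  end.

(* A randomized algorithm on n vertices using m random bits is a map from
   seeds {ffun 'I_m -> bool} (uniformly distributed) to query trees. *)
Definition failure_prob (n m : nat) (A : {ffun 'I_m -> bool} -> qtree n)
  (g : rel 'I_n) : R :=
  Rdiv (INR #|[set w : {ffun 'I_m -> bool} |
                 ~~ is_global_min_cut g (run (cut_value g) (A w)).1]|)
       (INR #|{ffun 'I_m -> bool}|).

(* Main.v *)
(* Let D be the minimum degree.  Singletons are cuts of value at least D, so
   assume that a minimum cut S has value less than D.

   Contraction.  Sample each vertex with probability 1/M, M ~ D / log n, and let
   every vertex v join a uniformly random sampled neighbour.  There are about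
   n/M classes.  Moving a vertex across S does not improve it, so v has at least
   D/2 neighbours on its own side, of which at least theta ~ log n are sampled
   (Chernoff).  Given the sample, S survives with probability
   prod_v 1 / (1 + c_v / s_v), where c_v and s_v count the sampled neighbours
   of v on the other side and on its own.  As s_v >= theta, and sum_v c_v has
   expectation 2 c(S) / M = O(theta), this is bounded below by a constant.

   Search.  Keep the set H of edges found so far, and let T be a lightest cut of
   H among the unions of classes.  If H contains all the edges across T, then T
   is a minimum cut of the contracted graph; otherwise binary search finds a new
   edge across T.  As long as T has fewer than D edges of H, this happens at most
   D times per class, that is O~(D * n/M) = O~(n) times in all.

   Repeating O(log n) times makes the failure probability at most 1/n. *)

Require Import Defs.
From Stdlib Require Import Reals Lra.
From mathcomp Require Import all_boot.
From mathcomp Require Import zify.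

Set Implicit Arguments.
Unset Strict Implicit.
Unset Printing Implicit Defensive.

(** * Elementary estimates *)

Lemma leq_expn_base m n e : m <= n -> m ^ e <= n ^ e.
Proof. by case: e => // e mn; rewrite leq_exp2r. Qed.

(* 1 + c / b <= (1 + 1 / a) ^ c, cleared of denominators. *)
Lemma bernoulli_expnS (a b c : nat) : a <= b -> (b + c) * a ^ c <= b * a.+1 ^ c.
Proof.
move=> ab; elim: c => [|c IH]; first by rewrite addn0.
have one_factor : (b + c.+1) * a <= a.+1 * (b + c) by nia.
rewrite !expnS; have := leq_mul one_factor (leqnn (a ^ c)).
by have := leq_mul (leqnn a.+1) IH; nia.
Qed.

(* 1 - c / (a + 1) <= (1 - 1 / (a + 1)) ^ c, cleared of denominators. *)
Lemma bernoulli_expn_pred (a c : nat) : (a.+1 - c) * a.+1 ^ c <= a.+1 * a ^ c.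
Proof.
elim: c => [|c IH]; first by rewrite subn0.
have one_factor : (a.+1 - c.+1) * a.+1 <= a * (a.+1 - c) by nia.
rewrite !expnS; have := leq_mul one_factor (leqnn (a.+1 ^ c)).
by have := leq_mul (leqnn a) IH; nia.
Qed.

Lemma leq_expnS_double (a c : nat) : 2 * c <= a.+1 -> a.+1 ^ c <= 2 * a ^ c.
Proof.
move=> ca; rewrite -(@leq_pmul2l a.+1) //.
have half : a.+1 <= 2 * (a.+1 - c) by lia.
have := leq_mul half (leqnn (a.+1 ^ c)).
by have := bernoulli_expn_pred a c; nia.
Qed.

Lemma leq_expnS_expn2 (a h N c : nat) :
  2 * h <= a.+1 -> c <= N * h -> a.+1 ^ c <= 2 ^ N * a ^ c.
Proof.
move=> ha; elim: N c => [|N IH] c cN.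
  by have -> : c = 0 by lia.
have -> : c = minn c h + (c - h) by lia.
rewrite !expnD expnS mulnACA; apply: leq_mul; last by apply: IH; lia.
by apply: leq_expnS_double; lia.
Qed.

Lemma prod_addn_le (I : finType) (a b : I -> nat) h N theta :
  0 < theta -> 2 * h <= theta.+1 -> (forall i, theta <= a i) ->
  \sum_i b i <= N * h -> \prod_i (a i + b i) <= 2 ^ N * \prod_i a i.
Proof.
move=> theta_gt0 h_theta a_theta sum_b.
have expn_theta_gt0 : 0 < theta ^ (\sum_i b i) by rewrite expn_gt0 theta_gt0.
have bernoulli : \prod_i (a i + b i) * theta ^ (\sum_i b i) <=
    \prod_i a i * theta.+1 ^ (\sum_i b i).
  rewrite !expn_sum -!big_split /=; apply: leq_prod => i _.
  exact: bernoulli_expnS (a_theta i).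
rewrite -(leq_pmul2r expn_theta_gt0); apply: leq_trans bernoulli _.
rewrite -mulnA mulnCA leq_mul2l; apply/orP; right.
exact: leq_expnS_expn2 h_theta sum_b.
Qed.

Lemma leq_double_expn_pred (k : nat) : 0 < k -> 2 * k.-1 ^ k <= k ^ k.
Proof.
case: k => [//|[|k]] _ //; rewrite -(@leq_pmul2l k.+1) //=.
apply: leq_trans (bernoulli_expnS k.+2 (leqnn k.+1)).
by rewrite mulnA leq_mul2r; apply/orP; right; lia.
Qed.

Lemma leq_expn2_expn_pred (k s c : nat) :
  0 < k -> k * s <= c -> 2 ^ s * k.-1 ^ c <= k ^ c.
Proof.
move=> k_gt0 ksc; rewrite -(subnKC ksc) !expnD !expnM mulnA -expnMn.
apply: leq_mul; apply: leq_expn_base; last exact: leq_pred.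
exact: leq_double_expn_pred.
Qed.

Definition lg (n : nat) : nat := (trunc_log 2 n).+1.

Lemma ltn_lg n : n < 2 ^ lg n.
Proof. exact: trunc_log_ltn. Qed.

(** * Query programs *)

Inductive prog (n : nat) (X : Type) : Type :=
| Ret of X
| Ask of {set 'I_n} & (nat -> prog n X).
Arguments Ret {n X} _.
Arguments Ask {n X} _ _.

Fixpoint bind n X Y (p : prog n X) (f : X -> prog n Y) : prog n Y :=
  match p with
  | Ret x => f x
  | Ask Q k => Ask Q (fun a => bind (k a) f)
  end.
Arguments bind : simpl never.

Notation "x <-- p ; q" := (bind p (fun x => q))
  (at level 61, p at next level, q at level 200, right associativity).

Fixpoint value n X (o : {set 'I_n} -> nat) (p : prog n X) : X :=
  match p with
  | Ret x => x
  | Ask Q k => value o (k (o Q))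
  end.

Fixpoint cost n X (o : {set 'I_n} -> nat) (p : prog n X) : nat :=
  match p with
  | Ret _ => 0
  | Ask Q k => (cost o (k (o Q))).+1
  end.

Fixpoint qtree_of n (p : prog n {set 'I_n}) : qtree n :=
  match p with
  | Ret Q => QLeaf Q
  | Ask Q k => QAsk Q (fun a => qtree_of (k a))
  end.

Definition ask n (S : {set 'I_n}) : prog n nat := Ask S Ret.

Fixpoint tabulate n X (f0 : 'I_n -> X) (f : 'I_n -> prog n X) (s : seq 'I_n) :
    prog n ('I_n -> X) :=
  if s is v :: s' then
    y <-- f v; h <-- tabulate f0 f s'; Ret (fun u => if u == v then y else h u)
  else Ret f0.

Fixpoint bisect n (count : nat -> prog n nat) (k t lo : nat) : prog n nat :=
  if t is t'.+1 then
    x <-- count (lo + 2 ^ t');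
    bisect count k t' (if x <= k then lo + 2 ^ t' else lo)
  else Ret lo.

Section Programs.
Variables (n : nat) (o : {set 'I_n} -> nat).

Lemma run_qtree_of (p : prog n {set 'I_n}) :
  run o (qtree_of p) = (value o p, cost o p).
Proof. by elim: p => //= S k IH; rewrite IH. Qed.

Lemma value_bind X Y (p : prog n X) (f : X -> prog n Y) :
  value o (bind p f) = value o (f (value o p)).
Proof. by elim: p => //= S k IH; rewrite IH. Qed.

Lemma cost_bind X Y (p : prog n X) (f : X -> prog n Y) :
  cost o (bind p f) = cost o p + cost o (f (value o p)).
Proof. by elim: p => //= S k IH; rewrite IH. Qed.

Lemma value_tabulate X f0 (f : 'I_n -> prog n X) s u :
  u \in s -> value o (tabulate f0 f s) u = value o (f u).
Proof.
elim: s => //= v s IH; rewrite inE !value_bind /=.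
by case: eqP => [->|_] //=; apply: IH.
Qed.

Lemma cost_tabulate X f0 (f : 'I_n -> prog n X) s c :
  (forall u, cost o (f u) <= c) -> cost o (tabulate f0 f s) <= size s * c.
Proof.
move=> fc; elim: s => //= v s IH; rewrite !cost_bind /= addn0 mulSn.
exact: leq_add.
Qed.

Lemma value_bisect count (F : nat -> nat) k t lo :
  (forall j, value o (count j) = F j) -> F lo <= k < F (lo + 2 ^ t) ->
  let j := value o (bisect count k t lo) in F j <= k < F j.+1.
Proof.
move=> countF; elim: t lo => [|t IH] lo /=; first by rewrite expn0 addn1.
rewrite value_bind countF => /andP[lo_k k_hi]; apply: IH.
case: (leqP (F (lo + 2 ^ t)) k) => [mid_k|k_mid]; last by rewrite lo_k.
by rewrite mid_k -addnA addnn -mul2n -expnS.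
Qed.

Lemma cost_bisect count k t lo c :
  (forall j, cost o (count j) <= c) -> cost o (bisect count k t lo) <= t * c.
Proof.
move=> count_c; elim: t lo => //= t IH lo; rewrite cost_bind mulSn.
exact: leq_add.
Qed.

End Programs.

(** * Edge counts *)

Lemma sum_nat_of_bool (T : finType) (P Q : pred T) :
  \sum_(x | P x) Q x = #|[set x | P x && Q x]|.
Proof. by rewrite -sum1dep_card big_mkcondr; apply: eq_bigr => x _; case: (Q x). Qed.

Definition edges n (g : rel 'I_n) (A B : {set 'I_n}) : nat :=
  \sum_(v in B) \sum_(u in A) g u v.

Definition rel_diff n (g h : rel 'I_n) : rel 'I_n := fun u v => g u v && ~~ h u v.

Definition prefix_set n (j : nat) : {set 'I_n} := [set u : 'I_n | u < j].

Section Edges.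
Variable n : nat.
Implicit Types (g h : rel 'I_n) (A B S : {set 'I_n}).

Lemma cut_value_sum g S :
  cut_value g S = \sum_(e | (e.1 \in S) && (e.2 \notin S)) g e.1 e.2.
Proof.
rewrite (sum_nat_of_bool _ (fun e => g e.1 e.2)); apply: eq_card => e.
by rewrite !inE andbC.
Qed.

Lemma cut_valueE g S : cut_value g S = edges g S (~: S).
Proof.
rewrite cut_value_sum /edges exchange_big /= pair_big.
by apply: eq_bigl => e; rewrite inE.
Qed.

Lemma edges_sym g A B : symmetric g -> edges g A B = edges g B A.
Proof.
move=> gs; rewrite /edges exchange_big /=.
by apply: eq_bigr => u _; apply: eq_bigr => v _; rewrite gs.
Qed.

Lemma edges0r g A : edges g A set0 = 0.
Proof. by rewrite /edges big_set0. Qed.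

Lemma edgesUr g A B1 B2 : [disjoint B1 & B2] ->
  edges g A (B1 :|: B2) = edges g A B1 + edges g A B2.
Proof.
by move=> d; rewrite /edges (eq_bigl [predU B1 & B2]) ?bigU //= => u; rewrite !inE.
Qed.

Lemma edgesUl g A1 A2 B : [disjoint A1 & A2] ->
  edges g (A1 :|: A2) B = edges g A1 B + edges g A2 B.
Proof.
move=> d; rewrite /edges -big_split /=.
apply: eq_bigr => v _; rewrite (eq_bigl [predU A1 & A2]) ?bigU //= => u.
by rewrite !inE.
Qed.

Lemma edges_subrel g h A B : subrel h g -> edges h A B <= edges g A B.
Proof.
move=> hg; apply: leq_sum => v _; apply: leq_sum => u _.
by case huv: (h u v) => //; rewrite hg.
Qed.

Lemma edges_rel_diff g h A B : subrel h g ->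
  edges (rel_diff g h) A B = edges g A B - edges h A B.
Proof.
move=> hg; apply/eqP; rewrite -(eqn_add2r (edges h A B)) subnK ?edges_subrel //.
rewrite /edges -big_split /=; apply/eqP; apply: eq_bigr => v _.
rewrite -big_split /=; apply: eq_bigr => u _; rewrite /rel_diff.
by case huv: (h u v); [rewrite (hg _ _ huv) | rewrite andbT addn0].
Qed.

Lemma rel_diff_sym g h : symmetric g -> symmetric h -> symmetric (rel_diff g h).
Proof. by move=> gs hs u v; rewrite /rel_diff gs hs. Qed.

Lemma cut_value_subrel g h S : subrel h g -> cut_value h S <= cut_value g S.
Proof. by move=> hg; rewrite !cut_valueE edges_subrel. Qed.

Lemma cut_valueC g S : symmetric g -> cut_value g (~: S) = cut_value g S.
Proof. by move=> gs; rewrite !cut_valueE setCK edges_sym. Qed.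

Lemma setC_disjointU A B : [disjoint A & B] -> ~: A = B :|: ~: (A :|: B).
Proof.
move=> /pred0P dAB; apply/setP => v; have /= := dAB v.
by rewrite !inE; case: (v \in A); case: (v \in B).
Qed.

Lemma cut_value_disjoint g A B : symmetric g -> [disjoint A & B] ->
  cut_value g A + cut_value g B = cut_value g (A :|: B) + 2 * edges g A B.
Proof.
move=> gs dAB; have dBA : [disjoint B & A] by rewrite disjoint_sym.
have outside (X : {set _}) : X \subset A :|: B -> [disjoint X & ~: (A :|: B)].
  by rewrite subsets_disjoint.
rewrite !cut_valueE {1}(setC_disjointU dAB) {1}(setC_disjointU dBA) (setUC B A).
rewrite !edgesUr ?outside ?subsetUl ?subsetUr // edgesUl // (edges_sym B A) //.
lia.
Qed.

Lemma prefix_setS (v : 'I_n) : prefix_set n v.+1 = v |: prefix_set n v.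
Proof. by apply/setP => u; rewrite !inE ltnS leq_eqVlt. Qed.

Lemma prefix_set_full j : n <= j -> prefix_set n j = setT.
Proof. by move=> nj; apply/setP => u; rewrite !inE (leq_trans (ltn_ord u) nj). Qed.

Lemma prefix_set0 : prefix_set n 0 = set0.
Proof. by apply/setP => u; rewrite !inE. Qed.

Lemma edges_prefix_setS g A B (v : 'I_n) :
  edges g A (B :&: prefix_set n v.+1) =
  edges g A (B :&: prefix_set n v) + (v \in B) * edges g A [set v].
Proof.
have v_out : [disjoint [set v] & prefix_set n v] by rewrite disjoints1 inE ltnn.
rewrite prefix_setS setIUr edgesUr; last first.
  by apply: disjointWl (subsetIr _ _) (disjointWr (subsetIr _ _) v_out).
rewrite addnC; congr (_ + _); case: (boolP (v \in B)) => vB.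
  by rewrite mul1n; congr (edges g A _); apply/setIidPr; rewrite sub1set.
by rewrite mul0n (disjoint_setI0 _) ?edges0r // disjoint_sym disjoints1.
Qed.

Definition count_between A B : prog n nat :=
  a <-- ask A; b <-- ask B; c <-- ask (A :|: B); Ret ((a + b - c)./2).

Lemma value_count_between g A B : symmetric g -> [disjoint A & B] ->
  value (cut_value g) (count_between A B) = edges g A B.
Proof.
move=> gs dAB; rewrite /count_between !value_bind /= cut_value_disjoint //.
by rewrite addKn mul2n doubleK.
Qed.

Definition count_unknown h A B : prog n nat :=
  x <-- count_between A B; Ret (x - edges h A B).

Lemma value_count_unknown g h A B :
  symmetric g -> subrel h g -> [disjoint A & B] ->
  value (cut_value g) (count_unknown h A B) = edges (rel_diff g h) A B.
Proof. by move=> gs hg dAB; rewrite value_bind value_count_between ?edges_rel_diff. Qed.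

(* Listing the unknown edges between A and B by their endpoint in B, returns the
   endpoint of number k; v0 is only a default value. *)
Definition find_endpoint h (v0 : 'I_n) A B (k : nat) : prog n 'I_n :=
  j <-- bisect (fun j => count_unknown h A (B :&: prefix_set n j)) k (lg n) 0;
  Ret (insubd v0 j).

Lemma cost_find_endpoint o h v0 A B k :
  cost o (find_endpoint h v0 A B k) <= 3 * lg n.
Proof. by rewrite /find_endpoint cost_bind addn0 mulnC cost_bisect. Qed.

Lemma value_find_endpoint g h v0 A B k :
  symmetric g -> subrel h g -> [disjoint A & B] ->
  let r := rel_diff g h in k < edges r A B ->
  let v := value (cut_value g) (find_endpoint h v0 A B k) in
  v \in B /\
  edges r A (B :&: prefix_set n v) <= k <
  edges r A (B :&: prefix_set n v) + edges r A [set v].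
Proof.
move=> gs hg dAB r k_lt v; pose F j := edges r A (B :&: prefix_set n j).
have F_full j : n <= j -> F j = edges r A B.
  by move=> nj; rewrite /F prefix_set_full ?setIT.
have countF j : value (cut_value g) (count_unknown h A (B :&: prefix_set n j)) = F j.
  by rewrite value_count_unknown // (disjointWr (subsetIl _ _) dAB).
have [|] := andP (value_bisect (lo := 0) (t := lg n) (k := k) countF _).
  by rewrite add0n (F_full _ (ltnW (ltn_lg n))) /F prefix_set0 setI0 edges0r.
set j := value _ _ => j_k k_jS.
have [jn|nj] := ltnP j n; last first.
  by move: j_k k_jS; rewrite !F_full ?(leqW nj) //; case: ltngtP.
have -> : v = Ordinal jn.
  by rewrite /v /find_endpoint value_bind; apply: val_inj; rewrite val_insubd -/j jn.
move: j_k k_jS; rewrite -[j]/(val (Ordinal jn)) /F edges_prefix_setS => j_k.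
by case: (_ \in B); rewrite ?mul1n ?mul0n ?addn0 ?j_k //; case: ltngtP j_k.
Qed.

End Edges.

(** * Sparse edge sequences *)

Section Sparse.
Variable L : finType.
Implicit Types (T W : {set L}) (e : L * L) (s : seq (L * L)) (D : nat).

Definition crosses T e : bool := (e.1 \in T) != (e.2 \in T).

Definition inside W e : bool := (e.1 \in W) && (e.2 \in W).

Fixpoint sparse D s : Prop :=
  if s is e :: s' then
    (exists2 T, crosses T e & count (crosses T) s <= D) /\ sparse D s'
  else True.

Lemma sparse_filter D (p : pred (L * L)) s : sparse D s -> sparse D (filter p s).
Proof.
elim: s => //= e s IH [[T Te cT] /IH {}IH]; case: ifP => // pe /=.
split=> //; exists T => //; apply: leq_trans cT.
by rewrite leq_add2l count_filter sub_count // => x /= /andP[].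
Qed.

Lemma crossesC T e : crosses (~: T) e = crosses T e.
Proof. by rewrite /crosses !inE; case: (e.1 \in T); case: (e.2 \in T). Qed.

Lemma size_crosses_inside T s :
  size s = count (crosses T) s + size (filter (inside T) s) +
           size (filter (inside (~: T)) s).
Proof.
rewrite !size_filter; elim: s => //= e s ->; rewrite /crosses /inside !inE.
by case: (e.1 \in T); case: (e.2 \in T); lia.
Qed.

Lemma crosses_inside_neq0 T W e : crosses T e -> inside W e -> W :&: T != set0.
Proof.
rewrite /crosses /inside => eT /andP[e1 e2]; apply/set0Pn; move: eT.
by case e1T: (e.1 \in T); case e2T: (e.2 \in T) => // _;
  [exists e.1 | exists e.2]; rewrite !inE ?e1 ?e2.
Qed.

Lemma all_inside_filter T W s :
  all (inside W) s -> all (inside (W :&: T)) (filter (inside T) s).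
Proof.
move=> /allP sW; apply/allP => e; rewrite mem_filter => /andP[/andP[e1 e2] /sW].
by rewrite /inside !inE e1 e2 !andbT.
Qed.

(* Split along the cut of the most recent edge: at most D edges cross it, and
   the two sides inherit the hypothesis. *)
Lemma size_sparse D s W :
  sparse D s -> W != set0 -> all (inside W) s -> size s + D <= D * #|W|.
Proof.
have [m W_m] := ubnP #|W|; elim: m => // m IH in W s W_m *.
case: s => [|e s'] s_sparse W0 sW; first by rewrite leq_pmulr // card_gt0.
have [[T Te T_light] _] := s_sparse; have [eW _] := andP sW.
move: (e :: s') s_sparse sW T_light => s s_sparse sW T_light.
have side_bound X : crosses X e -> #|W :&: X| < #|W| ->
    size (filter (inside X) s) + D <= D * #|W :&: X|.
  move=> Xe WX; apply: IH; first exact: leq_trans WX _.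
  - exact: sparse_filter.
  - exact: crosses_inside_neq0 eW.
  - exact: all_inside_filter.
have TCe : crosses (~: T) e by rewrite crossesC.
have card_W := cardsID T W; rewrite setDE in card_W.
have := crosses_inside_neq0 Te eW; have := crosses_inside_neq0 TCe eW.
rewrite -!card_gt0; have := side_bound _ Te; have := side_bound _ TCe.
by rewrite -card_W mulnDr (size_crosses_inside T s); lia.
Qed.

End Sparse.

(** * Finding a minimum cut of a contracted graph *)

Definition nontrivial n (S : {set 'I_n}) : bool := (S != set0) && (S != setT).

Definition compatible n (L : finType) (lab : 'I_n -> L) (S : {set 'I_n}) : bool :=
  nontrivial S && [exists T : {set L}, S == lab @^-1: T].

Definition rel_of n (s : seq ('I_n * 'I_n)) : rel 'I_n :=
  fun u v => ((u, v) \in s) || ((v, u) \in s).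

Definition find_edge n (h : rel 'I_n) (v0 : 'I_n) (X : {set 'I_n}) :
    prog n ('I_n * 'I_n) :=
  b <-- find_endpoint h v0 X (~: X) 0; a <-- find_endpoint h v0 [set b] X 0; Ret (a, b).

Section FindEdge.
Variable n : nat.
Implicit Types (g h : rel 'I_n) (S X : {set 'I_n}) (s : seq ('I_n * 'I_n)).

Lemma rel_of_sym s : symmetric (rel_of s).
Proof. by move=> u v; rewrite /rel_of orbC. Qed.

Lemma cut_value_rel_of_nil S : cut_value (rel_of [::]) S = 0.
Proof. by rewrite cut_value_sum big1. Qed.

Lemma cut_value_rel_of_cons s e S : e.1 != e.2 -> ~~ rel_of s e.1 e.2 ->
  cut_value (rel_of (e :: s)) S = crosses S e + cut_value (rel_of s) S.
Proof.
case: e => a b /= ab new.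
have eq_swap (u v : 'I_n) : ((v, u) == (a, b)) = ((u, v) == (b, a)).
  by rewrite !xpair_eqE andbC.
have rel_cons (e : 'I_n * 'I_n) : rel_of ((a, b) :: s) e.1 e.2 =
    (e == (a, b)) + (e == (b, a)) + rel_of s e.1 e.2 :> nat.
  case: e => u v; rewrite /rel_of !inE /= (eq_swap u v).
  have [[-> ->]|_] := (u, v) =P (a, b).
    by rewrite xpair_eqE (negPf ab) -/(rel_of s a b) (negPf new).
  have [[-> ->]|_] := (u, v) =P (b, a); last by [].
  by rewrite orbT -/(rel_of s b a) rel_of_sym (negPf new).
have sum_eq x : \sum_(e : 'I_n * 'I_n | (e.1 \in S) && (e.2 \notin S)) (e == x) =
    ((x.1 \in S) && (x.2 \notin S) : nat).
  rewrite big_mkcond (bigD1 x) //= eqxx big1 ?addn0; first by case: (_ && _).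
  by move=> e /negPf->; case: (_ && _).
rewrite !cut_value_sum; under eq_bigr => e _ do rewrite rel_cons.
rewrite !big_split /= !sum_eq /crosses /=; congr (_ + _).
by case: (a \in S); case: (b \in S).
Qed.

Lemma cost_find_edge o h v0 X : cost o (find_edge h v0 X) <= 6 * lg n.
Proof.
rewrite /find_edge cost_bind cost_bind addn0 (mulnDl 3 3).
by apply: leq_add; apply: cost_find_endpoint.
Qed.

Lemma value_find_edge g h v0 X : symmetric g -> symmetric h -> subrel h g ->
  cut_value h X < cut_value g X ->
  let e := value (cut_value g) (find_edge h v0 X) in
  [/\ e.1 \in X, e.2 \notin X, g e.1 e.2 & ~~ h e.1 e.2].
Proof.
move=> gs hs hg unknown e; pose r := rel_diff g h.
have unknown_cross : 0 < edges r X (~: X).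
  by rewrite edges_rel_diff // -!cut_valueE subn_gt0.
have disj_XC : [disjoint X & ~: X] by rewrite -subsets_disjoint.
have [] := value_find_endpoint v0 gs hg disj_XC unknown_cross.
set b := value _ _; rewrite inE => bX b_unknown.
have disj_bX : [disjoint [set b] & X] by rewrite disjoints1.
have unknown_b : 0 < edges r [set b] X.
  by rewrite edges_sym; [rewrite -/r in b_unknown; lia | apply: rel_diff_sym].
have [] := value_find_endpoint v0 gs hg disj_bX unknown_b.
set a := value _ _ => aX a_unknown.
have -> : e = (a, b) by rewrite /e /find_edge value_bind value_bind.
have : 0 < edges r [set b] [set a] by rewrite -/r in a_unknown; lia.
by rewrite /edges !big_set1 lt0b => /andP[gba hba]; rewrite gs hs.
Qed.

End FindEdge.

Section ContractedCut.
Variables (n : nat) (L : finType) (lab : 'I_n -> L) (D : nat) (v0 : 'I_n).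
Implicit Types (S X : {set 'I_n}) (s : seq ('I_n * 'I_n)).

Definition lightest s S : bool :=
  compatible lab S &&
  [forall X : {set 'I_n}, compatible lab X ==>
     (cut_value (rel_of s) S <= cut_value (rel_of s) X)].

(* Either the lightest known cut is certified by one query, or the query
   reveals an unknown edge across it. *)
Fixpoint contracted_cut (fuel : nat) s : prog n {set 'I_n} :=
  if fuel is fuel'.+1 then
    if [pick X | lightest s X] is Some X then
      if D <= cut_value (rel_of s) X then Ret set0 else
      c <-- ask X;
      if c == cut_value (rel_of s) X then Ret X else
      e <-- find_edge (rel_of s) v0 X; contracted_cut fuel' (e :: s)
    else Ret set0
  else Ret set0.

Lemma cost_contracted_cut o fuel s :
  cost o (contracted_cut fuel s) <= fuel * (6 * lg n + 1).
Proof.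
elim: fuel s => //= fuel IH s; case: pickP => [X _|//].
case: ifP => // _; rewrite cost_bind /=; case: ifP => _ /=; first by lia.
rewrite mulSn addnAC addn1 add1n ltnS cost_bind.
exact: leq_add (cost_find_edge _ _ _ _) (IH _).
Qed.

Lemma exists_lightest s S : compatible lab S -> exists X, lightest s X.
Proof.
move=> labS; have [X labX minX] := arg_minnP (cut_value (rel_of s)) labS.
by exists X; rewrite /lightest labX; apply/forallP => X'; apply/implyP/minX.
Qed.

Variable g : rel 'I_n.
Hypothesis simple_g : simple_graph g.

Definition known_edges s : Prop :=
  [/\ subrel (rel_of s) g,
      forall S, cut_value (rel_of s) S = count (crosses S) s &
      sparse D [seq (lab e.1, lab e.2) | e <- s]].

Lemma known_edges_nil : known_edges [::].
Proof. by split=> // S; rewrite cut_value_rel_of_nil. Qed.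

Lemma known_edges_cons s X e : known_edges s -> compatible lab X ->
  cut_value (rel_of s) X < D ->
  [/\ e.1 \in X, e.2 \notin X, g e.1 e.2 & ~~ rel_of s e.1 e.2] ->
  known_edges (e :: s).
Proof.
case: e => a b [sg s_count s_sparse] /andP[_ /existsP[T /eqP XT]] X_light /=.
move=> [aX bX gab new].
have crosses_lab e : crosses T (lab e.1, lab e.2) = crosses X e.
  by rewrite XT /crosses !inE.
have ab : a != b by apply: contraNneq bX => <-.
split.
- move=> u v /orP[]; rewrite inE => /orP[/eqP[-> ->]|uv_s] //.
  + by apply: sg; rewrite /rel_of uv_s.
  + by rewrite simple_g.1.
  + by apply: sg; rewrite /rel_of uv_s orbT.
- by move=> S; rewrite cut_value_rel_of_cons //= s_count.
- split=> //; exists T; first by rewrite (crosses_lab (a, b)) /crosses /= aX (negPf bX).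
  rewrite /= (crosses_lab (a, b)) count_map (eq_count (a2 := crosses X) crosses_lab).
  by rewrite -s_count; case: (crosses _ _) => //; apply: ltnW.
Qed.

Lemma size_known_edges s : known_edges s -> size s + D <= D * #|lab @: setT|.
Proof.
case=> _ _ s_sparse; rewrite -(size_map (fun e => (lab e.1, lab e.2)) s).
apply: size_sparse => //; first by apply/set0Pn; exists (lab v0); apply: imset_f.
by apply/allP => _ /mapP[e _ ->]; rewrite /inside /= !imset_f.
Qed.

Lemma value_contracted_cut S fuel s :
  compatible lab S -> cut_value g S < D -> known_edges s ->
  D * #|lab @: setT| <= size s + fuel ->
  let X := value (cut_value g) (contracted_cut fuel s) in
  nontrivial X /\ cut_value g X <= cut_value g S.
Proof.
move=> labS SD; elim: fuel s => [|fuel IH] s known enough_fuel.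
  by have := size_known_edges known; lia.
have [sg _ _] := known; rewrite /=.
have [X /andP[labX /forallP/(_ S)]|none] := pickP (lightest s); last first.
  by have [X] := exists_lightest s labS; rewrite none.
rewrite labS /= => X_lightest; have S_known := cut_value_subrel S sg.
have X_light : cut_value (rel_of s) X < D by lia.
rewrite leqNgt X_light value_bind /=; case: eqP => [X_known|X_unknown].
  by have [X_nontrivial _] := andP labX; split=> //=; lia.
rewrite value_bind; apply: IH; last by rewrite /= addSnnS.
apply: known_edges_cons labX X_light _ => //.
apply: value_find_edge => //; [exact: simple_g.1 | exact: rel_of_sym |].
by have := cut_value_subrel X sg; lia.
Qed.

End ContractedCut.

(** * Counting and random samples *)

Lemma sum_nat_modn (d q : nat) (F : nat -> nat) :
  \sum_(0 <= i < q * d) F (i %% d) = q * \sum_(0 <= i < d) F i.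
Proof.
elim: q => [|q IH]; first by rewrite big_geq.
rewrite mulSn (@big_cat_nat _ _ _ d) ?leq_addr //= mulSn; congr (_ + _).
  by rewrite !big_nat; apply: eq_bigr => i /andP[_ id]; rewrite modn_small.
rewrite -{1}[d]add0n big_addn addKn -IH.
by apply: eq_bigr => i _; rewrite modnDr.
Qed.

Lemma card_ord_modn (d m : nat) (P : pred nat) : d %| m ->
  #|[set z : 'I_m | P (z %% d)]| * d = m * #|[set k : 'I_d | P k]|.
Proof.
case/dvdnP => q ->.
have card_sum e (Q : pred nat) : #|[set z : 'I_e | Q z]| = \sum_(0 <= i < e) Q i.
  by rewrite big_mkord sum_nat_of_bool.
by rewrite (card_sum _ (fun i => P (i %% d))) card_sum (sum_nat_modn d q P) mulnAC.
Qed.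

Lemma markov_card (T : finType) (F : T -> nat) b :
  #|[set x | b <= F x]| * b <= \sum_x F x.
Proof.
rewrite -sum1dep_card big_distrl [leqRHS](bigID (fun x => b <= F x)) /=.
by apply: leq_trans (leq_addr _ _); apply: leq_sum => x bF; rewrite mul1n.
Qed.

Lemma markov_card_mean (T : finType) (F : T -> nat) k a : 0 < a ->
  \sum_x F x <= a * #|T| -> k * #|[set x | k * a <= F x]| <= #|T|.
Proof.
move=> a_gt0 meanF; rewrite -(leq_pmul2l a_gt0); apply: leq_trans meanF.
by apply: leq_trans (markov_card F (k * a)); rewrite mulnA mulnC (mulnC a).
Qed.

Lemma leq_card_bigcup (I T : finType) (F : I -> {set T}) :
  #|\bigcup_i F i| <= \sum_i #|F i|.
Proof.
elim/big_rec2: _ => [|i s U _ IH]; first by rewrite cards0.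
by apply: leq_trans (leq_card_setU _ _) _; rewrite leq_add2l.
Qed.

Lemma leq_card_sections (X Y : finType) (A : {set X * Y}) (G : {set X}) a b :
  #|X| <= a * #|G| ->
  (forall x, x \in G -> #|Y| <= b * #|[set y | (x, y) \in A]|) ->
  #|{: X * Y}| <= a * b * #|A|.
Proof.
move=> largeG large_section.
have -> : #|A| = \sum_x #|[set y | (x, y) \in A]|.
  under [RHS]eq_bigr => x _ do rewrite -sum1dep_card.
  by rewrite pair_big_dep -sum1_card; apply: eq_bigl => -[x y].
have GY : #|G| * #|Y| <= b * \sum_x #|[set y | (x, y) \in A]|.
  rewrite -sum_nat_const big_distrr [leqRHS](bigID (mem G)) /=.
  by apply: leq_trans (leq_addr _ _); apply: leq_sum.
rewrite card_prod -mulnA; apply: leq_trans (leq_mul largeG (leqnn _)) _.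
by rewrite -mulnA leq_mul2l GY orbT.
Qed.

Lemma card_ffun_forall (I X : finType) (G : I -> {set X}) :
  #|[set y : {ffun I -> X} | [forall v, y v \in G v]]| = \prod_v #|G v|.
Proof. by rewrite -cardsXn; apply: eq_card => y; rewrite !inE. Qed.

Section Sampling.
Variables (I X : finType) (Z : {set X}) (M : nat).
Hypotheses (M_gt0 : 0 < M) (MZ : M * #|Z| = #|X|).

Definition sampled (x : {ffun I -> X}) : {set I} := [set u | x u \in Z].

Lemma card_sampled u : M * #|[set x | u \in sampled x]| = #|X| ^ #|I|.
Proof.
have -> : #|[set x | u \in sampled x]| =
    \prod_v #|if v == u then Z else [set: X]|.
  rewrite -card_ffun_forall; apply: eq_card => x; rewrite !inE.
  apply/idP/forallP => [xu v|/(_ u)]; last by rewrite eqxx.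
  by case: eqP => [->|_]; rewrite ?inE.
rewrite (bigD1 u) //= eqxx mulnA MZ -prod_nat_const [RHS](bigD1 u) //=.
by congr (_ * _); apply: eq_bigr => v /negPf->; rewrite cardsT.
Qed.

Lemma sum_sampled (w : I -> nat) :
  M * \sum_(x : {ffun I -> X}) \sum_(u in sampled x) w u = #|X| ^ #|I| * \sum_u w u.
Proof.
under [in LHS]eq_bigr => x _ do rewrite big_mkcond.
rewrite exchange_big /= !big_distrr; apply: eq_bigr => u _ /=.
by rewrite -big_mkcond sum_nat_cond_const mulnA card_sampled.
Qed.

Lemma sum_expn2_unsampled (N : {set I}) :
  M ^ #|N| * \sum_(x : {ffun I -> X}) 2 ^ #|N :\: sampled x| =
  (2 * M).-1 ^ #|N| * #|X| ^ #|I|.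
Proof.
pose F (u : I) (z : X) := if u \in N then 1 + (z \notin Z) else 1.
have prodF (x : {ffun I -> X}) : 2 ^ #|N :\: sampled x| = \prod_u F u (x u).
  rewrite -prod_nat_const big_mkcond; apply: eq_bigr => u _.
  by rewrite /F !inE; case: (x u \in Z); case: (u \in N).
have sumF u : u \in N -> M * \sum_z F u z = (2 * M).-1 * #|X|.
  move=> uN; rewrite /F uN big_split /= sum1_card sum_nat_of_bool -MZ.
  have -> : #|[set z | true && (z \notin Z)]| = #|~: Z|.
    by apply: eq_card => z; rewrite !inE.
  by have := cardsC Z; rewrite -MZ; nia.
under eq_bigr => x _ do rewrite prodF.
rewrite -(bigA_distr_bigA F) -!prod_nat_const.
rewrite [X in _ * X = _](bigID (mem N)) [X in _ = _ * X](bigID (mem N)) /=.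
rewrite !mulnA -!big_split /=.
congr (_ * _); apply: eq_bigr => u uN; first exact: sumF.
by rewrite /F (negPf uN) sum1_card.
Qed.

(* Chernoff's method, with the moment 2 ^ #|N :\: sampled x|. *)
Lemma sampled_lower_tail (N : {set I}) s theta : 2 * M * s <= #|N| ->
  #|[set x | #|N :&: sampled x| < theta]| * 2 ^ s <= 2 ^ theta * #|X| ^ #|I|.
Proof.
move=> sN; set few := [set x | _].
have few_moment : #|few| * 2 ^ #|N| <=
    2 ^ theta * \sum_(x : {ffun I -> X}) 2 ^ #|N :\: sampled x|.
  rewrite big_distrr; apply: leq_trans (markov_card _ (2 ^ #|N|)) => /=.
  rewrite leq_mul2r; apply/orP; right; apply/subset_leq_card/subsetP => x.
  rewrite !inE => x_few; rewrite -expnD leq_pexp2l //.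
  by have := cardsID (sampled x) N; lia.
have decay : 2 ^ s * (2 * M).-1 ^ #|N| <= (2 * M) ^ #|N|.
  by apply: leq_expn2_expn_pred; rewrite ?muln_gt0.
have positive : 0 < (2 * M) ^ #|N| by rewrite expn_gt0 muln_gt0 M_gt0.
rewrite -(leq_pmul2l positive).
rewrite [leqRHS]mulnC; apply: leq_trans (leq_mul (leqnn _) decay).
have -> : (2 * M) ^ #|N| * (#|few| * 2 ^ s) = 2 ^ s * M ^ #|N| * (#|few| * 2 ^ #|N|).
  by rewrite expnMn; lia.
apply: leq_trans (leq_mul (leqnn _) few_moment) _.
by rewrite -mulnA (mulnCA (M ^ _)) sum_expn2_unsampled; lia.
Qed.

End Sampling.

(** * Minimum cuts and degrees *)

Section MinCuts.
Variable n : nat.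
Implicit Types (g : rel 'I_n) (S : {set 'I_n}).

Lemma disjoint_set1D1 (v : 'I_n) S : [disjoint [set v] & S :\ v].
Proof. by rewrite disjoints1 !inE eqxx. Qed.

Lemma nontrivialC S : nontrivial (~: S) = nontrivial S.
Proof. by rewrite /nontrivial !(can2_eq (@setCK _) (@setCK _)) setC0 setCT andbC. Qed.

Lemma nontrivial_set1 (v : 'I_n) : 1 < n -> nontrivial [set v].
Proof.
move=> n_gt1; rewrite /nontrivial -card_gt0 cards1 /=.
apply/eqP => /(congr1 (fun S : {set 'I_n} => #|S|)).
by rewrite cards1 cardsT card_ord; lia.
Qed.

Lemma nontrivial_gt0 S : nontrivial S -> 0 < n.
Proof. by case/andP => /set0Pn[u _] _; apply: leq_ltn_trans (ltn_ord u). Qed.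

Lemma is_global_min_cutP g S :
  reflect (nontrivial S /\ forall T, nontrivial T -> cut_value g S <= cut_value g T)
          (is_global_min_cut g S).
Proof.
rewrite /is_global_min_cut andbA; apply: (iffP andP) => -[ntS minS]; split=> //.
  by move=> T; apply: implyP (forallP minS T).
by apply/forallP => T; apply/implyP/minS.
Qed.

Lemma is_global_min_cutC g S : symmetric g ->
  is_global_min_cut g S -> is_global_min_cut g (~: S).
Proof.
move=> gs /is_global_min_cutP[ntS minS]; apply/is_global_min_cutP.
by rewrite nontrivialC cut_valueC.
Qed.

Lemma exists_global_min_cut g : 1 < n -> exists S, is_global_min_cut g S.
Proof.
move=> n_gt1; have nt1 := nontrivial_set1 (Ordinal n_gt1) n_gt1.
have [S ntS minS] := arg_minnP (cut_value g) nt1.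
by exists S; apply/is_global_min_cutP.
Qed.

End MinCuts.

Section Degrees.
Variables (n : nat) (g : rel 'I_n).
Hypothesis simple_g : simple_graph g.
Implicit Types (S R : {set 'I_n}) (u v : 'I_n).

Definition nbrs v : {set 'I_n} := [set u | g v u].

Definition side S v : {set 'I_n} := if v \in S then S else ~: S.

Definition same_degree S R v : nat := #|nbrs v :&: R :&: side S v|.

Definition cross_degree S R v : nat := #|nbrs v :&: R :\: side S v|.

Lemma mem_side S v u : (u \in side S v) = ((u \in S) == (v \in S)).
Proof. by rewrite /side; case: (v \in S); rewrite ?inE; case: (u \in S). Qed.

Lemma same_degreeD_cross S R v :
  same_degree S R v + cross_degree S R v = #|nbrs v :&: R|.
Proof. exact: cardsID. Qed.

Lemma edges_set1 v R : edges g [set v] R = #|nbrs v :&: R|.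
Proof.
rewrite /edges; under eq_bigr => u _ do rewrite big_set1.
by rewrite sum_nat_of_bool; apply: eq_card => u; rewrite !inE andbC.
Qed.

Lemma nbrsD1 v R : nbrs v :&: (R :\ v) = nbrs v :&: R.
Proof. by apply/setP => u; rewrite !inE; case: eqP => [->|] //=; rewrite simple_g.2. Qed.

Lemma cut_value_set1 v : cut_value g [set v] = #|nbrs v|.
Proof. by rewrite cut_valueE edges_set1 -setTD nbrsD1 setIT. Qed.

Lemma cut_value_nbrs S : cut_value g S = \sum_(v in S) #|nbrs v :&: ~: S|.
Proof.
rewrite cut_valueE (edges_sym _ _ simple_g.1); apply: eq_bigr => v _.
rewrite -edges_set1 /edges; apply: eq_bigr => u _.
by rewrite big_set1 simple_g.1.
Qed.

Lemma sum_cross_degree_setT S : \sum_v cross_degree S setT v = 2 * cut_value g S.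
Proof.
rewrite mul2n -addnn -{2}(cut_valueC S simple_g.1) !cut_value_nbrs setCK.
rewrite (bigID (mem S)) /=; congr (_ + _); apply: eq_big => v.
- by [].
- by move=> vS; rewrite /cross_degree /side vS setIT setDE.
- by rewrite inE.
- by move=> /negPf vS; rewrite /cross_degree /side vS setIT setDE setCK.
Qed.

Lemma sum_cross_degree S R :
  \sum_v cross_degree S R v = \sum_(u in R) cross_degree S setT u.
Proof.
under eq_bigr => v _ do rewrite /cross_degree -sum1_card.
under [RHS]eq_bigr => u _ do rewrite /cross_degree -sum1_card.
rewrite (exchange_big_dep (mem R)) /=; last by move=> v u _; rewrite !inE => /and3P[].
apply: eq_bigr => u uR; apply: eq_bigl => v.
by rewrite !inE !mem_side uR !andbT simple_g.1 eq_sym.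
Qed.

(* Otherwise moving v across would improve the cut. *)
Lemma cross_degree_le_same S v :
  is_global_min_cut g S -> cut_value g S < cut_value g [set v] ->
  cross_degree S setT v <= same_degree S setT v.
Proof.
move=> minS; have : is_global_min_cut g (side S v) /\
    cut_value g (side S v) = cut_value g S.
  by rewrite /side; case: ifP => // _; rewrite cut_valueC ?is_global_min_cutC //;
    apply: simple_g.1.
case=> /is_global_min_cutP[_ min_side] <- v_large.
have v_side : v \in side S v by rewrite mem_side.
rewrite /cross_degree /same_degree setIT; set P := side S v in min_side v_large v_side *.
have ntP : nontrivial (P :\ v).
  rewrite /nontrivial setD_eq0 subset1 negb_or; apply/andP; split.
    apply/andP; split; last by apply/set0Pn; exists v.
    by apply: contraTneq v_large => ->; rewrite ltnn.
  by apply/eqP => /setP/(_ v); rewrite !inE eqxx.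
have := cut_value_disjoint simple_g.1 (disjoint_set1D1 v P); have := min_side _ ntP.
rewrite setD1K // edges_set1 cut_value_set1 -(cardsID P (nbrs v)) nbrsD1.
lia.
Qed.

Lemma min_degree_le_same S D v : is_global_min_cut g S ->
  D <= cut_value g [set v] -> cut_value g S < D -> D <= 2 * same_degree S setT v.
Proof.
move=> minS Dv SD; have := cross_degree_le_same minS (leq_trans SD Dv).
by have := same_degreeD_cross S setT v; move: Dv; rewrite cut_value_set1 setIT; lia.
Qed.

End Degrees.

(** * Star contraction *)

Section StarContraction.
Variable n : nat.
Implicit Types (R : {set 'I_n}) (v : 'I_n) (k i : nat) (z : 'I_n -> nat).

Definition nth_nbr R v k : prog n 'I_n :=
  find_endpoint [rel _ _ | false] v [set v] (R :\ v) k.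

Definition pick_nbr R v i : prog n 'I_n :=
  d <-- count_between [set v] (R :\ v);
  if d == 0 then Ret v else nth_nbr R v (i %% d).

Definition star_contraction R (z : 'I_n -> nat) : prog n ('I_n -> 'I_n) :=
  tabulate id (fun v => pick_nbr R v (z v)) (enum 'I_n).

Lemma cost_pick_nbr o R v i : cost o (pick_nbr R v i) <= 3 * lg n + 3.
Proof.
rewrite /pick_nbr cost_bind addnC leq_add //.
by case: ifP => // _; apply: cost_find_endpoint.
Qed.

Lemma cost_star_contraction o R z :
  cost o (star_contraction R z) <= n * (3 * lg n + 3).
Proof.
rewrite -[n in n * _]size_enum_ord; apply: cost_tabulate => v.
exact: cost_pick_nbr.
Qed.

Variable g : rel 'I_n.
Hypothesis simple_g : simple_graph g.
Local Notation result p := (value (cut_value g) p).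

Lemma value_nth_nbr R v k : k < #|nbrs g v :&: R| ->
  let u := result (nth_nbr R v k) in
  u \in nbrs g v :&: R /\ k = edges g [set v] ((R :\ v) :&: prefix_set n u).
Proof.
move=> k_lt u; pose r := rel_diff g [rel _ _ | false].
have edges_r A B : edges r A B = edges g A B.
  by apply: eq_bigr => y _; apply: eq_bigr => x _; rewrite /r /rel_diff andbT.
have k_lt_r : k < edges r [set v] (R :\ v) by rewrite edges_r edges_set1 nbrsD1.
have [//|] := value_find_endpoint v simple_g.1 _ (disjoint_set1D1 v R) k_lt_r.
rewrite -/(nth_nbr R v k) -/u -/r !edges_r => uR /andP[u_le u_gt].
have edge_vu : edges g [set v] [set u] = g v u by rewrite /edges !big_set1.
have gvu : g v u by move: u_gt; rewrite edge_vu; case: (g v u) => //; lia.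
by rewrite edge_vu gvu in u_gt; rewrite !inE gvu in uR *; split; [case/andP: uR | lia].
Qed.

Lemma nth_nbr_inj R v k k' : k < #|nbrs g v :&: R| -> k' < #|nbrs g v :&: R| ->
  result (nth_nbr R v k) = result (nth_nbr R v k') -> k = k'.
Proof. by move=> /value_nth_nbr[_ {2}->] /value_nth_nbr[_ {2}->] ->. Qed.

Lemma value_pick_nbr R v i : 0 < #|nbrs g v :&: R| ->
  result (pick_nbr R v i) = result (nth_nbr R v (i %% #|nbrs g v :&: R|)).
Proof.
move=> d_gt0; rewrite /pick_nbr value_bind value_count_between ?disjoint_set1D1 //.
  by rewrite edges_set1 nbrsD1 // eqn0Ngt d_gt0.
exact: simple_g.1.
Qed.

Lemma pick_nbr_mem R v i : 0 < #|nbrs g v :&: R| -> result (pick_nbr R v i) \in R.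
Proof.
move=> d_gt0; rewrite value_pick_nbr //.
by have [] := value_nth_nbr (ltn_pmod i d_gt0); rewrite inE => /andP[].
Qed.

Lemma card_pick_nbr R v m P : 0 < #|nbrs g v :&: R| -> #|nbrs g v :&: R| %| m ->
  m * #|nbrs g v :&: R :&: P| <=
  #|[set z : 'I_m | result (pick_nbr R v z) \in P]| * #|nbrs g v :&: R|.
Proof.
set d := #|_ :&: R| => d_gt0 dm.
under eq_finset => z do rewrite value_pick_nbr //.
rewrite (card_ord_modn (fun k => result (nth_nbr R v k) \in P)) // leq_mul2l.
set K := [set k : 'I_d | _]; apply/orP; right.
have inj : {in ~: K &, injective (fun k : 'I_d => result (nth_nbr R v k))}.
  by move=> k k' _ _ /nth_nbr_inj eq_k; apply: val_inj; apply: eq_k.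
have : #|~: K| <= #|nbrs g v :&: R :\: P|.
  rewrite -(card_in_imset inj); apply/subset_leq_card/subsetP => u /imsetP[k].
  rewrite !inE => kP ->; rewrite kP.
  by have [] := value_nth_nbr (ltn_ord k); rewrite !inE.
have := cardsID P (nbrs g v :&: R); rewrite -/d.
by have := cardsC K; rewrite card_ord; lia.
Qed.

Lemma value_star_contraction R z v :
  result (star_contraction R z) v = result (pick_nbr R v (z v)).
Proof. by rewrite value_tabulate ?mem_enum. Qed.

Lemma star_contraction_classes R z : (forall v, 0 < #|nbrs g v :&: R|) ->
  #|result (star_contraction R z) @: setT| <= #|R|.
Proof.
move=> d_gt0; apply/subset_leq_card/subsetP => _ /imsetP[v _ ->].
by rewrite value_star_contraction pick_nbr_mem.
Qed.

Lemma compatible_star_contraction R z S : nontrivial S ->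
  (forall v, result (pick_nbr R v (z v)) \in side S v) ->
  compatible (result (star_contraction R z)) S.
Proof.
move=> ntS z_side; rewrite /compatible ntS; apply/existsP; exists S; apply/eqP/setP => v.
by rewrite inE value_star_contraction; have := z_side v; rewrite mem_side => /eqP.
Qed.

End StarContraction.

Lemma card_star_contraction n (g : rel 'I_n) m (R S : {set 'I_n}) N h theta :
  simple_graph g -> (forall d, 0 < d -> d <= n -> d %| m) -> nontrivial S ->
  0 < theta -> 2 * h <= theta.+1 -> (forall v, theta <= same_degree g S R v) ->
  \sum_v cross_degree g S R v <= N * h ->
  m ^ n <= 2 ^ N * #|[set y : {ffun 'I_n -> 'I_m} |
    compatible (value (cut_value g) (star_contraction R (fun v => y v))) S]|.
Proof.
move=> simple_g n_dvd ntS theta_gt0 h_theta same cross.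
pose good v := [set z : 'I_m | value (cut_value g) (pick_nbr R v z) \in side S v].
apply: leq_trans (_ : 2 ^ N * \prod_v #|good v| <= _); last first.
  rewrite leq_mul2l -card_ffun_forall; apply/orP; right.
  apply/subset_leq_card/subsetP => y; rewrite !inE => /forallP y_good.
  by apply: compatible_star_contraction => // v; have := y_good v; rewrite inE.
have degree_pos v : 0 < #|nbrs g v :&: R|.
  by have := same v; have := same_degreeD_cross g S R v; lia.
have picks : m ^ n * \prod_v same_degree g S R v <=
    \prod_v #|good v| * \prod_v (same_degree g S R v + cross_degree g S R v).
  rewrite -{1}(card_ord n) -prod_nat_const -!big_split /=.
  apply: leq_prod => v _; rewrite same_degreeD_cross; apply: card_pick_nbr => //.
  by apply: n_dvd => //; rewrite -[leqRHS]card_ord max_card.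
have same_pos : 0 < \prod_v same_degree g S R v.
  by apply: prodn_gt0 => v; apply: leq_trans (same v).
rewrite -(leq_pmul2r same_pos); apply: leq_trans picks _.
rewrite mulnAC mulnC leq_mul2r; apply/orP; right.
exact: prod_addn_le h_theta same cross.
Qed.

(** * The algorithm *)

(* A number uniform below n! is uniform modulo every d <= n. *)
Definition seed (n : nat) : finType := {ffun 'I_n -> 'I_(n`!)}.

Lemma card_seed n : #|seed n| = #|'I_(n`!)| ^ #|'I_n|.
Proof. exact: card_ffun. Qed.

Definition multiples (m M : nat) : {set 'I_m} := [set z : 'I_m | z %% M == 0].

Lemma card_multiples m M : 0 < M -> M %| m -> M * #|multiples m M| = m.
Proof.
move=> M_gt0 Mm; rewrite mulnC (card_ord_modn (fun i => i == 0)) //.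
rewrite (_ : [set k : 'I_M | _] = [set Ordinal M_gt0]) ?cards1 ?muln1 //.
by apply/setP => k; rewrite !inE.
Qed.

Section Algorithm.
Variable n : nat.
Let h := lg n + 2.

(* The sampling probability is the inverse of the rate. *)
Definition rate (D : nat) : nat := D %/ (16 * h).

Definition sample (D : nat) (x : seed n) : {set 'I_n} :=
  sampled (multiples n`! (rate D)) x.

Definition contraction (D : nat) (w : seed n * seed n) : prog n ('I_n -> 'I_n) :=
  if D < 16 * h then Ret id else star_contraction (sample D w.1) (fun v => w.2 v).

Definition classes (D : nat) : nat := if D < 16 * h then n else 4 * n %/ rate D.

Definition attempt (D : nat) (v0 : 'I_n) (w : seed n * seed n) : prog n {set 'I_n} :=
  lab <-- contraction D w; contracted_cut lab D v0 (D * classes D) [::].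

Fixpoint improve (D : nat) (v0 : 'I_n) (ws : seq (seed n * seed n))
    (best : {set 'I_n} * nat) : prog n ({set 'I_n} * nat) :=
  if ws is w :: ws' then
    T <-- attempt D v0 w; c <-- ask T;
    improve D v0 ws' (if nontrivial T && (c < best.2) then (T, c) else best)
  else Ret best.

Definition min_cut_prog (ws : seq (seed n * seed n)) : prog n {set 'I_n} :=
  deg <-- tabulate (fun=> 0) (fun v => ask [set v]) (enum 'I_n);
  if [pick v | [forall u, deg v <= deg u]] is Some v then
    best <-- improve (deg v) v ws ([set v], deg v); Ret best.1
  else Ret set0.

Lemma rate_gt0 D : 16 * h <= D -> 0 < rate D.
Proof. by move=> hD; rewrite divn_gt0. Qed.

Lemma rate_le D : 16 * h * rate D <= D.
Proof. by rewrite mulnC leq_divM. Qed.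

Lemma le_rate D : 16 * h <= D -> D <= 32 * h * rate D.
Proof.
move=> hD; have := rate_gt0 hD; have := @ltn_ceil D (16 * h) isT.
by rewrite -/(rate D); nia.
Qed.

Lemma classes_le D : D * classes D <= 128 * h * n.
Proof.
rewrite /classes; case: ltnP => hD; first by nia.
have := leq_mul (le_rate hD) (leqnn (4 * n %/ rate D)).
by have := leq_divM (4 * n) (rate D); nia.
Qed.

Lemma cost_attempt o D v0 w :
  cost o (attempt D v0 w) <= n * (3 * lg n + 3) + 128 * h * n * (6 * lg n + 1).
Proof.
rewrite /attempt cost_bind; apply: leq_add.
  by rewrite /contraction; case: ifP => // _; apply: cost_star_contraction.
apply: leq_trans (cost_contracted_cut _ _ _ _ _ _) _.
by rewrite leq_mul2r classes_le orbT.
Qed.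

Lemma cost_improve o D v0 ws best c :
  (forall w, cost o (attempt D v0 w) <= c) ->
  cost o (improve D v0 ws best) <= size ws * c.+1.
Proof.
move=> attempt_c; elim: ws best => //= w ws IH best.
by rewrite cost_bind mulSn addSnnS leq_add // cost_bind add1n ltnS IH.
Qed.

Lemma cost_min_cut_prog o ws :
  cost o (min_cut_prog ws) <=
  n + size ws * (n * (3 * lg n + 3) + 128 * h * n * (6 * lg n + 1)).+1.
Proof.
rewrite /min_cut_prog cost_bind; apply: leq_add.
  by apply: leq_trans (cost_tabulate _ _ (c := 1) _) _; rewrite // size_enum_ord muln1.
case: pickP => [v _|//]; rewrite cost_bind addn0; apply: cost_improve => w.
exact: cost_attempt.
Qed.

Section Correctness.
Variable g : rel 'I_n.
Hypothesis simple_g : simple_graph g.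
Local Notation c := (cut_value g).

Lemma value_improve D v0 ws best : nontrivial best.1 -> best.2 = c best.1 ->
  let r := value c (improve D v0 ws best) in
  [/\ nontrivial r.1, r.2 = c r.1, r.2 <= best.2 &
      forall w, w \in ws -> let T := value c (attempt D v0 w) in
        nontrivial T -> r.2 <= c T].
Proof.
elim: ws best => [|w ws IH] best nt_best best_c //=.
rewrite value_bind /=; set T := value c (attempt D v0 w); rewrite value_bind /=.
set b := (if _ then _ else _).
have [||nt_r r_c r_b r_ws] := IH b; try by rewrite /b; case: ifP => // /andP[].
have b_best : b.2 <= best.2 by rewrite /b; case: ifP => // /andP[_ /ltnW].
split=> //; first exact: leq_trans b_best.
move=> w'; rewrite inE => /orP[/eqP -> ntT|]; last exact: r_ws.
by apply: leq_trans r_b _; rewrite /b -/T ntT; case: ltnP.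
Qed.

Definition good_seed (D : nat) (S : {set 'I_n}) (w : seed n * seed n) : bool :=
  let lab := value c (contraction D w) in
  (#|lab @: setT| <= classes D) && compatible lab S.

Lemma value_attempt D v0 w S : good_seed D S w -> c S < D ->
  let T := value c (attempt D v0 w) in nontrivial T /\ c T <= c S.
Proof.
case/andP=> few_classes labS SD; rewrite /attempt value_bind.
apply: value_contracted_cut => //; first exact: known_edges_nil.
by rewrite leq_mul2l few_classes orbT.
Qed.

Lemma value_min_cut_prog ws S v : 1 < n -> is_global_min_cut g S ->
  (forall u, c [set v] <= c [set u]) ->
  (c S < c [set v] -> has (good_seed (c [set v]) S) ws) ->
  is_global_min_cut g (value c (min_cut_prog ws)).
Proof.
move=> n_gt1 /is_global_min_cutP[_ minS] min_v has_good.
rewrite /min_cut_prog value_bind; set deg := value c (tabulate _ _ _).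
have degE u : deg u = c [set u] by rewrite /deg value_tabulate ?mem_enum.
case: pickP => [u /forallP min_u|none]; last first.
  by have /forallP[] := none v; move=> u; rewrite !degE.
have Ev : c [set v] = deg u.
  by apply/eqP; rewrite eqn_leq -{2}degE min_u degE min_v.
rewrite Ev in has_good; rewrite value_bind /=.
have [nt_r r_c r_u r_ws] :=
  @value_improve (deg u) u ws ([set u], deg u) (nontrivial_set1 u n_gt1) (degE u).
apply/is_global_min_cutP; split=> // T /minS; apply: leq_trans; rewrite -r_c.
have [Su|uS] := ltnP (c S) (deg u); last exact: leq_trans uS.
have [w w_ws good] := hasP (has_good Su).
have [ntT TS] := value_attempt u good Su.
exact: leq_trans (r_ws w w_ws ntT) TS.
Qed.

Definition good_sample (D : nat) (S : {set 'I_n}) (x : seed n) : bool :=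
  [&& [forall v, 2 * h <= same_degree g S (sample D x) v],
      \sum_v cross_degree g S (sample D x) v < 4 * (64 * h) &
      rate D * #|sample D x| < 4 * n].

Section LargeDegree.
Variables (D : nat) (S : {set 'I_n}).
Hypotheses (minS : is_global_min_cut g S) (min_degD : forall u, D <= c [set u]).
Hypotheses (SD : c S < D) (hD : 16 * h <= D).
Let ntS : nontrivial S := (is_global_min_cutP _ _ minS).1.
Let n_gt0 : 0 < n := nontrivial_gt0 ntS.

Lemma mul_rate_card_multiples : rate D * #|multiples n`! (rate D)| = #|'I_(n`!)|.
Proof.
rewrite card_ord card_multiples ?rate_gt0 // dvdn_fact // rate_gt0 //=.
apply: leq_trans (@leq_pmull _ (16 * h) isT) (leq_trans (rate_le D) _).
apply: leq_trans (min_degD (Ordinal n_gt0)) _.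
by rewrite cut_value_set1 // -[leqRHS](card_ord n) max_card.
Qed.

(* A union bound over the vertices: each of them has at least D / 2 neighbours on
   its own side, hence at least 8h of them are sampled on average. *)
Lemma card_low_same_degree :
  4 * #|[set x | ~~ [forall v, 2 * h <= same_degree g S (sample D x) v]]| <= #|seed n|.
Proof.
pose low v := [set x : seed n | #|nbrs g v :&: side S v :&: sample D x| < 2 * h].
have low_subset : [set x | ~~ [forall v, 2 * h <= same_degree g S (sample D x) v]]
    \subset \bigcup_v low v.
  apply/subsetP => x; rewrite inE => /forallPn[v]; rewrite -ltnNge => v_low.
  by apply/bigcupP; exists v; rewrite // inE setIAC.
have card_low v : #|low v| * 2 ^ (2 * h) <= #|seed n|.
  have many_same : 2 * rate D * (4 * h) <= #|nbrs g v :&: side S v|.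
    have := min_degree_le_same simple_g minS (min_degD v) SD.
    by rewrite /same_degree setIT; have := rate_le D; nia.
  have := sampled_lower_tail (rate_gt0 hD) mul_rate_card_multiples (2 * h) many_same.
  rewrite -card_seed (_ : 4 * h = 2 * h + 2 * h); last by lia.
  by rewrite expnD mulnA mulnC leq_pmul2l ?expn_gt0.
have sum_low : (\sum_v #|low v|) * 2 ^ (2 * h) <= n * #|seed n|.
  rewrite big_distrl; apply: leq_trans (_ : \sum_(v : 'I_n) #|seed n| <= _).
    exact: leq_sum.
  by rewrite sum_nat_const card_ord.
have n_small : n * 4 <= 2 ^ (2 * h).
  apply: leq_trans (leq_mul (ltnW (ltn_lg n)) (leqnn (2 ^ 2))) _.
  by rewrite -expnD leq_pexp2l // /h; lia.
rewrite -(leq_pmul2l n_gt0) mulnA mulnC; apply: leq_trans sum_low.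
apply: leq_mul n_small.
exact: leq_trans (subset_leq_card low_subset) (leq_card_bigcup low).
Qed.

Lemma card_high_cross_degree :
  4 * #|[set x | 4 * (64 * h) <= \sum_v cross_degree g S (sample D x) v]| <= #|seed n|.
Proof.
apply: markov_card_mean; first by rewrite muln_gt0 /h addn2.
under eq_bigr => x _ do rewrite sum_cross_degree //.
rewrite -(leq_pmul2l (rate_gt0 hD)) (sum_sampled mul_rate_card_multiples) -card_seed.
by rewrite sum_cross_degree_setT //; have := le_rate hD; move: SD; nia.
Qed.

Lemma card_large_sample :
  4 * #|[set x : seed n | 4 * n <= rate D * #|sample D x|]| <= #|seed n|.
Proof.
apply: markov_card_mean; first exact: n_gt0.
rewrite -big_distrr /=; under eq_bigr => x _ do rewrite -sum1_card.
by rewrite (sum_sampled mul_rate_card_multiples) -card_seed sum1_card card_ord mulnC.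
Qed.

Lemma card_good_sample : #|seed n| <= 4 * #|[set x | good_sample D S x]|.
Proof.
set good := [set x | good_sample D S x].
have := cardsC good; have := card_low_same_degree.
have := card_high_cross_degree; have := card_large_sample.
set large := [set x | _]; set high := [set x | _]; set low := [set x | _].
have : #|~: good| <= #|low| + #|high| + #|large|.
  apply: leq_trans (_ : #|low :|: high :|: large| <= _); last first.
    apply: leq_trans (leq_card_setU _ _) _; rewrite leq_add2r.
    exact: leq_card_setU.
  apply/subset_leq_card/subsetP => x; rewrite !inE /good_sample.
  by rewrite !negb_and -!leqNgt orbA.
lia.
Qed.

Lemma card_good_seed_section x : good_sample D S x ->
  #|seed n| <= 2 ^ 256 * #|[set y | good_seed D S (x, y)]|.
Proof.
case/and3P=> /forallP same cross small.
have h_gt0 : 0 < 2 * h by rewrite muln_gt0 /h addn2.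
have n_dvd d : 0 < d -> d <= n -> d %| n`! by move=> d_gt0 dn; rewrite dvdn_fact ?d_gt0.
have cross_h : \sum_v cross_degree g S (sample D x) v <= 256 * h.
  by apply: leq_trans (ltnW cross) _; rewrite mulnA.
have := card_star_contraction simple_g n_dvd ntS h_gt0 (leqnSn _) same cross_h.
have -> : n`! ^ n = #|seed n| by rewrite card_seed !card_ord.
move/leq_trans; apply; rewrite leq_mul2l; apply/orP; right.
apply/subset_leq_card/subsetP => y; rewrite !inE /good_seed /contraction ltnNge hD /=.
move=> ->; rewrite andbT /classes ltnNge hD leq_divRL ?rate_gt0 // mulnC.
apply: leq_trans (ltnW small); rewrite leq_mul2l; apply/orP; right.
apply: star_contraction_classes => // v.
by apply: leq_trans h_gt0 (leq_trans (same v) _); apply/subset_leq_card/subsetIl.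
Qed.

End LargeDegree.

Lemma card_good_seed D S : is_global_min_cut g S ->
  (forall u, D <= c [set u]) -> c S < D ->
  #|{: seed n * seed n}| <= 4 * 2 ^ 256 * #|[set w | good_seed D S w]|.
Proof.
move=> minS min_degD SD; have [hD|hD] := ltnP D (16 * h); last first.
  apply: leq_card_sections (card_good_sample minS min_degD SD hD) _ => x.
  rewrite inE => /(card_good_seed_section minS hD).
  by under [in X in _ -> X]eq_finset => y do rewrite inE.
have -> : [set w | good_seed D S w] = setT; last first.
  by rewrite cardsT; apply: leq_pmull; rewrite muln_gt0 expn_gt0.
apply/setP => w; rewrite !inE /good_seed /contraction /classes hD /=.
rewrite (leq_trans (max_card _)) ?card_ord //=.
rewrite /compatible; have [-> _] := is_global_min_cutP _ _ minS.
by apply/existsP; exists S; apply/eqP/setP => v; rewrite inE.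
Qed.

End Correctness.
End Algorithm.

(** * Amplification and the seed space *)

Lemma card_no_success (Y : finType) (good : pred Y) (Q s : nat) :
  0 < Q -> #|Y| <= Q * #|[set y | good y]| ->
  #|[set w : {ffun 'I_(Q * s) -> Y} | ~~ has good (codom w)]| * 2 ^ s
  <= #|{ffun 'I_(Q * s) -> Y}|.
Proof.
move=> Q_gt0 many_good; set bad := ~: [set y | good y].
have -> : #|[set w : {ffun 'I_(Q * s) -> Y} | ~~ has good (codom w)]| = #|bad| ^ (Q * s).
  rewrite -[X in _ ^ X]card_ord -card_ffun_on; apply: eq_card => w; rewrite inE.
  apply/hasPn/ffun_onP => [none t|none _ /codomP[t ->]].
    by rewrite !inE; apply/none/codom_f.
  by have := none t; rewrite !inE.
have expn_Q_gt0 : 0 < Q ^ (Q * s) by rewrite expn_gt0 Q_gt0.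
have few_bad : #|bad| * Q <= #|Y| * Q.-1.
  by have := cardsC [set y | good y]; rewrite -/bad; nia.
rewrite card_ffun card_ord -(leq_pmul2r expn_Q_gt0) mulnAC -expnMn.
apply: leq_trans (leq_mul (leq_expn_base _ few_bad) (leqnn _)) _.
by rewrite expnMn -mulnA leq_mul2l [_ * 2 ^ s]mulnC leq_expn2_expn_pred ?orbT.
Qed.

Section Decode.
Variables (W Om : finType).
Hypothesis Om_gt0 : 0 < #|Om|.

Definition decode (w : W) : Om :=
  enum_val (Ordinal (ltn_pmod (enum_rank w) Om_gt0)).

(* The fibres of decode have size at most #|W| / #|Om| + 1. *)
Lemma card_decode (F : {set Om}) : #|Om| <= #|W| ->
  #|[set w | decode w \in F]| * #|Om| <= 2 * #|W| * #|F|.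
Proof.
move=> OmW; set q := #|W| %/ #|Om|.
have quot_lt (w : W) : enum_rank w %/ #|Om| < q.+1 by rewrite ltnS leq_div2r // ltnW.
pose rank_divmod w : Om * 'I_q.+1 := (decode w, Ordinal (quot_lt w)).
have rank_divmod_inj : injective rank_divmod.
  move=> w w' [] /enum_val_inj[eq_mod] eq_div; apply: enum_rank_inj; apply: val_inj => /=.
  by rewrite (divn_eq (enum_rank w) #|Om|) (divn_eq (enum_rank w') #|Om|) eq_mod eq_div.
have fibres : #|[set w | decode w \in F]| <= #|F| * q.+1.
  rewrite -[q.+1]card_ord -cardsT -cardsX -(card_imset _ rank_divmod_inj).
  apply/subset_leq_card/subsetP => _ /imsetP[w wF ->].
  by rewrite !inE in wF *; rewrite wF.
have q_le : q.+1 * #|Om| <= 2 * #|W|.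
  by have := leq_divM #|W| #|Om|; rewrite -/q; lia.
apply: leq_trans (leq_mul fibres (leqnn _)) _.
by rewrite -mulnA mulnC leq_mul2r q_le orbT.
Qed.

End Decode.

Lemma Rdiv_INR_le_inv (a b c : nat) : 0 < b -> 0 < c -> a * c <= b ->
  Rle (Rdiv (INR a) (INR b)) (Rinv (INR c)).
Proof.
move=> b0 c0 /leP/le_INR; rewrite mult_INR => ac_b.
have INR_gt0 x : 0 < x -> Rlt 0 (INR x) by move=> /ltP/lt_0_INR.
have := INR_gt0 _ b0; have := INR_gt0 _ c0.
move: (INR a) (INR b) (INR c) ac_b => x y z xz_y z0 y0.
apply: (Rmult_le_reg_r (Rmult y z)); first exact: Rmult_lt_0_compat.
rewrite (_ : Rmult (Rdiv x y) _ = Rmult x z); last by field; lra.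
by rewrite (_ : Rmult (Rinv z) _ = y); last by field; lra.
Qed.

Definition trials (Q n : nat) : finType :=
  {ffun 'I_(Q * (lg n).+1) -> (seed n * seed n)%type}.

Lemma trials_gt0 Q n : 0 < #|trials Q n|.
Proof.
apply/card_gt0P; have x : seed n := [ffun=> Ordinal (fact_gt0 n)].
by exists [ffun=> (x, x)].
Qed.

Definition min_cut_algorithm Q n (w : {ffun 'I_(#|trials Q n|) -> bool}) : qtree n :=
  qtree_of (min_cut_prog (codom (decode (trials_gt0 Q n) w))).

Lemma algorithm_queries_le Q n g w : 0 < n ->
  (run (cut_value g) (@min_cut_algorithm Q n w)).2 <=
  (2696 * (2 * Q) + 1) * n * lg n ^ 3.
Proof.
move=> n_gt0; rewrite /min_cut_algorithm run_qtree_of /=.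
apply: leq_trans (cost_min_cut_prog _ _) _; rewrite size_codom card_ord.
have : 0 < lg n by []; move: (lg n) => L L0.
have attempt_cost :
    (n * (3 * L + 3) + 128 * (L + 2) * n * (6 * L + 1)).+1 <= 2696 * n * L ^ 2.
  by rewrite !expnS expn0 muln1; nia.
have trials_cost : Q * L.+1 <= 2 * Q * L by nia.
have degree_cost : n <= n * L ^ 3 by rewrite leq_pmulr // expn_gt0 L0.
apply: leq_trans (leq_add degree_cost (leq_mul trials_cost attempt_cost)) _.
by rewrite (expnS L 2); move: 2696 (L ^ 2) => c L2; apply: eq_leq; lia.
Qed.

Lemma card_failing_trials Q n (g : rel 'I_n) :
  1 < n -> 4 * 2 ^ 256 <= Q -> simple_graph g ->
  #|[set ws : trials Q n |
      ~~ is_global_min_cut g (value (cut_value g) (min_cut_prog (codom ws)))]| *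
  2 ^ (lg n).+1 <= #|trials Q n|.
Proof.
move=> n_gt1 Q_large simple_g; have [S minS] := exists_global_min_cut g n_gt1.
have Q_gt0 : 0 < Q by apply: leq_trans Q_large; rewrite muln_gt0 expn_gt0.
have [v _ min_v] :=
  @arg_minnP _ (Ordinal n_gt1) xpredT (fun u => cut_value g [set u]) isT.
have {}min_v u : cut_value g [set v] <= cut_value g [set u] by apply: min_v.
have correct (ws : trials Q n) :=
  value_min_cut_prog (ws := codom ws) simple_g n_gt1 minS min_v.
have [Sv|vS] := ltnP (cut_value g S) (cut_value g [set v]); last first.
  rewrite (_ : [set ws | _] = set0) ?cards0 //; apply/setP => ws.
  by rewrite !inE correct // ltnNge vS.
have many_good := card_good_seed simple_g minS min_v Sv.
have := card_no_success (lg n).+1 Q_gt0 (leq_trans many_good (leq_mul Q_large (leqnn _))).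
apply: leq_trans; rewrite leq_mul2r; apply/orP; right.
apply/subset_leq_card/subsetP => ws; rewrite !inE.
by apply: contraNN => ws_good; apply: correct.
Qed.

Lemma algorithm_failure_prob_le Q n g : 1 < n -> 4 * 2 ^ 256 <= Q -> simple_graph g ->
  Rle (failure_prob (@min_cut_algorithm Q n) g) (Rinv (INR n)).
Proof.
move=> n_gt1 Q_large simple_g; have := card_failing_trials n_gt1 Q_large simple_g.
set F := [set ws | _] => few_failing.
pose W : finType := {ffun 'I_(#|trials Q n|) -> bool}.
have card_W : #|W| = 2 ^ #|trials Q n| by rewrite card_ffun card_bool card_ord.
have large_W : #|trials Q n| <= #|W| by rewrite card_W ltnW // ltn_expl.
apply: Rdiv_INR_le_inv; rewrite -/W ?card_W ?expn_gt0 //; first exact: ltnW.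
have := card_decode (trials_gt0 Q n) F large_W.
rewrite (_ : [set w | _] = [set w : W |
  ~~ is_global_min_cut g (run (cut_value g) (@min_cut_algorithm Q n w)).1]); last first.
  by apply/setP => w; rewrite !inE run_qtree_of.
set failing := #|_| => failing_F; rewrite -card_W.
apply: leq_trans (leq_mul (leqnn failing) (ltnW (ltn_lg n))) _.
rewrite -(leq_pmul2r (trials_gt0 Q n)) mulnAC.
apply: leq_trans (leq_mul failing_F (leqnn _)) _.
apply: leq_trans (leq_mul (leqnn #|W|) few_failing).
by rewrite expnS; apply: eq_leq; lia.
Qed.

Theorem mainTheorem1 :
  exists (m : nat -> nat) (A : forall n : nat, {ffun 'I_(m n) -> bool} -> qtree n),
  exists (C k n0 : nat) (c : R),
    Rlt 0 c /\
    forall n : nat, n0 <= n ->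
    forall g : rel 'I_n, simple_graph g ->
      (* Õ(n) queries, on every graph and every random seed *)
      (forall w : {ffun 'I_(m n) -> bool},
          (run (cut_value g) (A n w)).2 <= C * n * (trunc_log 2 n).+1 ^ k) /\
      (* exact global min cut with probability >= 1 - n^{-c} *)
      Rle (failure_prob (A n) g) (Rpower (INR n) (Ropp c)).
Proof.
have [Q Q_large] : exists Q, 4 * 2 ^ 256 <= Q by move: (4 * _) => Q; exists Q.
exists (fun n => #|trials Q n|), (@min_cut_algorithm Q).
exists (2696 * (2 * Q) + 1), 3, 2, (IZR 1).
split; first lra.
move=> n n_gt1 g simple_g; split=> [w|].
  by apply: algorithm_queries_le; apply: ltnW.
rewrite Rpower_Ropp Rpower_1; last by apply: lt_0_INR; apply/ltP/ltnW.
exact: algorithm_failure_prob_le.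
Qed.
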